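(* Let $X$ be a small generated space and $x\in X$. Then $\pi_1^{qtop}(X,x)$ is an indiscrete topological group.
   Context: All homotopies of paths are relative to end points. $\pi_1^{qtop}(X,x)$ is the group $\pi_1(X,x)$ with the quotient topology induced by the canonical map $q:\Omega(X,x)\to\pi_1(X,x)$, $q(\alpha)=[\alpha]$, where $\Omega(X,x)$ is the space of loops in $X$ based at $x$ with the compact-open topology. For $y\in X$, the small loop group $\pi_1^s(X,y)\le \pi_1(X,y)$ is the subgroup of all classes $[\beta]$ of loops $\beta$ at $y$ such that for every open neighborhood $V$ of $y$, $\beta$ is homotopic to a loop at $y$ lying in $V$. The SG (small generated) subgroup $\pi_1^{sg}(X,x)$ is the subgroup of $\pi_1(X,x)$ generated by all elements $[\alpha*\beta*\alpha^{-1}]$, where $\alpha$ is a path in $X$ with $\alpha(0)=x$ and $[\beta]\in\pi_1^s(X,\alpha(1))$. A space $X$ is called small generated if $\pi_1(X,x)=\pi_1^{sg}(X,x)$ for every $x\in X$. *)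

(* Defs.v *)
From HB Require Import structures.
From mathcomp Require Import all_boot all_order all_algebra generic_quotient.
From mathcomp Require Import all_classical all_reals all_analysis.
From mathcomp Require Import homotopy.
From mathcomp Require Import lra.

Set Implicit Arguments.
Unset Strict Implicit.
Unset Printing Implicit Defensive.

Import Order.TTheory GRing.Theory Num.Theory.
Import numFieldNormedType.Exports.

Local Open Scope classical_set_scope.
Local Open Scope quotient_scope.
Local Open Scope ring_scope.

(* [set_type] carries the subspace topology inherited from [R]. *)
Definition unitI (R : realType) : Type := set_type (`[0, 1]%classic : set R).

HB.instance Definition _ (R : realType) := Topological.on (unitI R).

Section unit_interval.
Context {R : realType}.
Local Notation I := (unitI R).

Definition ival (t : I) : R := set_val t.

Definition clip (r : R) : R := Num.max 0 (Num.min r 1).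

Lemma clip_itv (r : R) : clip r \in (`[0, 1]%classic : set R).
Proof.
apply/mem_set; rewrite /= in_itv /= /clip /Num.max /Num.min.
by case: ifP; case: ifP; lra.
Qed.

(* The retraction of [R] onto the unit interval; it serves to turn a real
   number already known to lie between 0 and 1 into a point of [unitI R]. *)
Definition clamp (r : R) : I := exist _ (clip r) (clip_itv r).

Lemma ival_clamp r : ival (clamp r) = clip r. Proof. by []. Qed.

Lemma ival_inj : injective ival.
Proof. exact: val_inj. Qed.

Lemma ival_ge0 (t : I) : 0 <= ival t.
Proof. by have := set_valP t; rewrite /= in_itv /= => /andP[]. Qed.

Lemma ival_le1 (t : I) : ival t <= 1.
Proof. by have := set_valP t; rewrite /= in_itv /= => /andP[]. Qed.

Lemma clip_id (r : R) : 0 <= r -> r <= 1 -> clip r = r.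
Proof. by rewrite /clip /Num.max /Num.min; case: ifP; case: ifP; lra. Qed.

Lemma ivalK : cancel ival clamp.
Proof.
by move=> t; apply: ival_inj; rewrite ival_clamp clip_id ?ival_ge0 ?ival_le1.
Qed.

Lemma unitI_neq : clamp 0 != clamp 1.
Proof.
apply/eqP => /(congr1 ival); rewrite !ival_clamp !clip_id //; lra.
Qed.

HB.instance Definition _ := isBiPointed.Build I unitI_neq.

Lemma ival0 : ival zero = 0. Proof. by rewrite ival_clamp clip_id. Qed.
Lemma ival1 : ival one = 1. Proof. by rewrite ival_clamp clip_id. Qed.

Lemma ival_continuous : continuous ival.
Proof. exact: initial_continuous. Qed.

Lemma clip_continuous : continuous clip.
Proof.
move=> r; apply: (@continuous_max R R (cst 0) (fun r => Num.min r 1)).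
  exact: cvg_cst.
apply: (@continuous_min R R id (cst 1)); [exact: cvg_id|exact: cvg_cst].
Qed.

Lemma clamp_continuous : continuous clamp.
Proof. by apply: continuous_comp_initial; exact: clip_continuous. Qed.

End unit_interval.

Lemma continuous_glue {R : realType} {S X : topologicalType}
    (h : S -> R) (c : R) (f g : S -> X) :
  continuous h -> continuous f -> continuous g ->
  (forall s, h s = c -> f s = g s) ->
  continuous (fun s => if h s <= c then f s else g s).
Proof.
move=> ch cf cg fg; set k := fun s => _.
apply/continuous_subspace_setT.
have -> : [set: S] = [set s | h s <= c] `|` [set s | c <= h s].
  by apply/seteqP; split=> // s _ /=; case: (leP (h s) c) => [|/ltW]; [left|right].
have clA : closed [set s | h s <= c].
  by apply: (@preimage_closed _ _ h [set r | r <= c]) => [? _|]; [exact: ch|exact: closed_le].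
have clB : closed [set s | c <= h s].
  by apply: (@preimage_closed _ _ h [set r | c <= r]) => [? _|]; [exact: ch|exact: closed_ge].
have fk : {in [set s | h s <= c], f =1 k}.
  by move=> s /set_mem /= hs; rewrite /k hs.
have gk : {in [set s | c <= h s], g =1 k}.
  move=> s /set_mem /= hs; rewrite /k; case: ifP => // hs'.
  by rewrite fg //; apply/eqP; rewrite eq_le hs hs'.
apply: withinU_continuous => //.
- apply: (@subspace_eq_continuous _ _ _ _ _ fk); exact: continuous_subspaceT.
- apply: (@subspace_eq_continuous _ _ _ _ _ gk); exact: continuous_subspaceT.
Qed.

Section homotopy.
Context {R : realType} {X : topologicalType}.
Local Notation I := (unitI R).
Implicit Types x y z w : X.

Definition path_homotopy x y (f g : {path I from x to y}) (H : I * I -> X) :=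
  [/\ continuous H,
      forall t, H (t, zero) = f t,
      forall t, H (t, one) = g t,
      forall s, H (zero, s) = x &
      forall s, H (one, s) = y].

Definition homotopic x y (f g : {path I from x to y}) :=
  exists H, path_homotopy f g H.

Lemma path_continuous x y (f : {path I from x to y}) : continuous f.
Proof. exact: cts_fun. Qed.

Lemma fst_continuous {S T : topologicalType} : continuous (@fst S T).
Proof. by move=> p; exact: cvg_fst. Qed.

Lemma snd_continuous {S T : topologicalType} : continuous (@snd S T).
Proof. by move=> p; exact: cvg_snd. Qed.

Lemma continuous_compose {S T U : topologicalType} (f : S -> T) (g : T -> U) :
  continuous f -> continuous g -> continuous (fun s => g (f s)).
Proof. by move=> cf cg s; exact: (continuous_comp (cf s) (cg _)). Qed.

Lemma continuous_pair {S T U : topologicalType} (f : S -> T) (g : S -> U) :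
  continuous f -> continuous g -> continuous (fun s => (f s, g s)).
Proof. by move=> cf cg s; exact: cvg_pair (cf s) (cg s). Qed.

Lemma continuous_affine {S : topologicalType} (f : S -> R) (a b : R) :
  continuous f -> continuous (fun s => a * f s + b).
Proof.
by move=> cf s; apply: cvgD; [apply: cvgM; [exact: cvg_cst|exact: cf]|exact: cvg_cst].
Qed.

Lemma continuous_scale {S : topologicalType} (f : S -> R) (a : R) :
  continuous f -> continuous (fun s => a * f s).
Proof. by move=> cf s; apply: cvgM; [exact: cvg_cst|exact: cf]. Qed.

Lemma continuous_sub1 {S : topologicalType} (f : S -> R) :
  continuous f -> continuous (fun s => 1 - f s).
Proof. by move=> cf s; apply: cvgB; [exact: cvg_cst|exact: cf]. Qed.

Lemma homotopic_reparam x y a b (f : {path I from x to y}) (phi psi : R -> R)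
    (p q : {path I from a to b}) :
  continuous phi -> continuous psi -> phi 0 = psi 0 -> phi 1 = psi 1 ->
  (forall t, p t = f (clamp (phi (ival t)))) ->
  (forall t, q t = f (clamp (psi (ival t)))) ->
  homotopic p q.
Proof.
move=> cphi cpsi e0 e1 pE qE.
exists (fun ts => f (clamp (phi (ival ts.1) +
  ival ts.2 * (psi (ival ts.1) - phi (ival ts.1))))); split => /=.
- apply: continuous_compose; last exact: path_continuous.
  apply: continuous_compose; last exact: clamp_continuous.
  have c1 : continuous (fun ts : I * I => ival ts.1).
    by apply: continuous_compose ival_continuous; exact: fst_continuous.
  have c2 : continuous (fun ts : I * I => ival ts.2).
    by apply: continuous_compose ival_continuous; exact: snd_continuous.
  have cp := continuous_compose c1 cphi; have cq := continuous_compose c1 cpsi.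
  move=> ts; apply: cvgD; first exact: cp.
  by apply: cvgM; [exact: c2|apply: cvgB; [exact: cq|exact: cp]].
- by move=> t; rewrite ival0 mul0r addr0 pE.
- by move=> t; rewrite ival1 mul1r addrC subrK qE.
- by move=> s; rewrite ival0 e0 subrr mulr0 addr0 -e0 -ival0 -pE path_zero.
- by move=> s; rewrite ival1 e1 subrr mulr0 addr0 -e1 -ival1 -pE path_one.
Qed.

Lemma homotopic_eq x y (p q : {path I from x to y}) : p =1 q -> homotopic p q.
Proof.
move=> pq; have cid : continuous (@id R) by move=> ?; exact: cvg_id.
by apply: (homotopic_reparam (f := p) cid cid) => // t; rewrite ivalK ?pq.
Qed.

Lemma homotopic_refl x y (p : {path I from x to y}) : homotopic p p.
Proof. exact: homotopic_eq. Qed.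

Lemma homotopic_sym x y (p q : {path I from x to y}) :
  homotopic p q -> homotopic q p.
Proof.
case=> H [cH H0 H1 Hx Hy].
exists (fun ts => H (ts.1, clamp (- 1 * ival ts.2 + 1))); split => //=.
- apply: continuous_compose cH; apply: continuous_pair; first exact: fst_continuous.
  apply: continuous_compose clamp_continuous; apply: continuous_affine.
  by apply: continuous_compose ival_continuous; exact: snd_continuous.
- by move=> t; rewrite ival0 mulr0 add0r -ival1 ivalK.
- by move=> t; rewrite ival1 mulr1 addNr -ival0 ivalK.
Qed.

Lemma homotopic_trans x y (p q r : {path I from x to y}) :
  homotopic p q -> homotopic q r -> homotopic p r.
Proof.
case=> H [cH H0 H1 Hx Hy] [K [cK K0 K1 Kx Ky]].
exists (fun ts => if ival ts.2 <= 2^-1 then H (ts.1, clamp (2 * ival ts.2 + 0))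
                  else K (ts.1, clamp (2 * ival ts.2 + - 1))).
have c2 : continuous (fun ts : I * I => ival ts.2).
  by apply: continuous_compose ival_continuous; exact: snd_continuous.
split=> /=.
- apply: continuous_glue => //.
  + apply: continuous_compose cH; apply: continuous_pair; first exact: fst_continuous.
    by apply: continuous_compose clamp_continuous; exact: continuous_affine.
  + apply: continuous_compose cK; apply: continuous_pair; first exact: fst_continuous.
    by apply: continuous_compose clamp_continuous; exact: continuous_affine.
  + move=> [t s] /= ->; rewrite addr0 divff // subrr.
    by rewrite -{1}ival1 -ival0 !ivalK H1 K0.
- by move=> t; rewrite ival0 ifT ?invr_ge0 // mulr0 addr0 -ival0 ivalK.
- move=> t; rewrite ival1 ifF; last by apply/negbTE; rewrite -ltNge; lra.
  by rewrite (_ : 2 * 1 + - 1 = ival one :> R) ?ivalK // ival1; lra.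
- by move=> s; case: ifP.
- by move=> s; case: ifP.
Qed.

Section concatenation.
Context {x y z : X} (f : {path I from x to y}) (g : {path I from y to z}).

Definition concat_fun (t : I) : X :=
  if ival t <= 2^-1 then f (clamp (2 * ival t)) else g (clamp (2 * ival t - 1)).

Lemma concat_continuous : continuous concat_fun.
Proof.
have cf : continuous (fun t : I => clamp (2 * ival t)).
  apply: continuous_compose clamp_continuous.
  exact/continuous_scale/ival_continuous.
have cg : continuous (fun t : I => clamp (2 * ival t - 1)).
  apply: continuous_compose clamp_continuous.
  exact/continuous_affine/ival_continuous.
have {}cf := continuous_compose cf (@path_continuous _ _ f).
have {}cg := continuous_compose cg (@path_continuous _ _ g).
apply: (continuous_glue ival_continuous cf cg) => t ->; rewrite divff // subrr.
by rewrite -{1}ival1 -ival0 !ivalK path_zero path_one.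
Qed.

Lemma concat_zero : concat_fun zero = x.
Proof.
by rewrite /concat_fun ival0 ifT ?invr_ge0 // mulr0 -ival0 ivalK path_zero.
Qed.

Lemma concat_one : concat_fun one = z.
Proof.
rewrite /concat_fun ival1 ifF; last by apply/negbTE; rewrite -ltNge; lra.
by rewrite (_ : 2 * 1 - 1 = ival one :> R) ?ivalK ?path_one // ival1; lra.
Qed.

Definition concat : {path I from x to z} :=
  mk_path concat_continuous concat_zero concat_one.

Lemma concatE t : concat t = concat_fun t. Proof. by []. Qed.

End concatenation.

Section inversion.
Context {x y : X} (f : {path I from x to y}).

Definition rev_fun (t : I) : X := f (clamp (1 - ival t)).

Lemma rev_continuous : continuous rev_fun.
Proof.
have c : continuous (fun t : I => clamp (1 - ival t)).
  apply: continuous_compose clamp_continuous.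
  exact/continuous_sub1/ival_continuous.
exact: (continuous_compose c (@path_continuous _ _ f)).
Qed.

Lemma rev_zero : rev_fun zero = y.
Proof. by rewrite /rev_fun ival0 subr0 -ival1 ivalK path_one. Qed.

Lemma rev_one : rev_fun one = x.
Proof. by rewrite /rev_fun ival1 subrr -ival0 ivalK path_zero. Qed.

Definition rev_path : {path I from y to x} :=
  mk_path rev_continuous rev_zero rev_one.

Lemma rev_pathE t : rev_path t = rev_fun t. Proof. by []. Qed.

End inversion.

Definition cst_path x : {path I from x to x} := cst x.

Lemma homotopic_concat x y z (f f' : {path I from x to y})
    (g g' : {path I from y to z}) :
  homotopic f f' -> homotopic g g' -> homotopic (concat f g) (concat f' g').
Proof.
case=> H [cH H0 H1 Hx Hy] [K [cK K0 K1 Kx Ky]].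
exists (fun ts => if ival ts.1 <= 2^-1 then H (clamp (2 * ival ts.1 + 0), ts.2)
                  else K (clamp (2 * ival ts.1 + - 1), ts.2)).
have c1 : continuous (fun ts : I * I => ival ts.1).
  by apply: continuous_compose ival_continuous; exact: fst_continuous.
split=> /=.
- apply: continuous_glue => //.
  + apply: continuous_compose cH; apply: continuous_pair; last exact: snd_continuous.
    by apply: continuous_compose clamp_continuous; exact: continuous_affine.
  + apply: continuous_compose cK; apply: continuous_pair; last exact: snd_continuous.
    by apply: continuous_compose clamp_continuous; exact: continuous_affine.
  + move=> [t s] /= ->; rewrite addr0 divff // subrr.
    by rewrite -{1}ival1 -ival0 !ivalK Hy Kx.
- by move=> t; rewrite concatE /concat_fun addr0 H0 K0.
- by move=> t; rewrite concatE /concat_fun addr0 H1 K1.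
- by move=> s; rewrite ival0 ifT ?invr_ge0 // mulr0 addr0 -ival0 ivalK.
- move=> s; rewrite ival1 ifF; last by apply/negbTE; rewrite -ltNge; lra.
  by rewrite (_ : 2 * 1 + - 1 = ival one :> R) ?ivalK // ival1; lra.
Qed.

Lemma homotopic_rev x y (f g : {path I from x to y}) :
  homotopic f g -> homotopic (rev_path f) (rev_path g).
Proof.
case=> H [cH H0 H1 Hx Hy].
exists (fun ts => H (clamp (- 1 * ival ts.1 + 1), ts.2)); split => /=.
- apply: continuous_compose cH; apply: continuous_pair; last exact: snd_continuous.
  apply: continuous_compose clamp_continuous; apply: continuous_affine.
  by apply: continuous_compose ival_continuous; exact: fst_continuous.
- by move=> t; rewrite rev_pathE /rev_fun H0 mulN1r addrC.
- by move=> t; rewrite rev_pathE /rev_fun H1 mulN1r addrC.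
- by move=> s; rewrite ival0 mulr0 add0r -ival1 ivalK.
- by move=> s; rewrite ival1 mulr1 addNr -ival0 ivalK.
Qed.

Lemma continuous_affineR (a b : R) : continuous (fun r : R => a * r + b).
Proof. by apply: continuous_affine => ?; exact: cvg_id. Qed.

Lemma continuous_minR (f g : R -> R) :
  continuous f -> continuous g -> continuous (fun r => Num.min (f r) (g r)).
Proof. by move=> cf cg r; apply: (@continuous_min R R f g); [exact: cf|exact: cg]. Qed.

Lemma continuous_maxR (f g : R -> R) :
  continuous f -> continuous g -> continuous (fun r => Num.max (f r) (g r)).
Proof. by move=> cf cg r; apply: (@continuous_max R R f g); [exact: cf|exact: cg]. Qed.

Lemma homotopic_concatA x y z w (f : {path I from x to y})
    (g : {path I from y to z}) (h : {path I from z to w}) :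
  homotopic (concat f (concat g h)) (concat (concat f g) h).
Proof.
apply: (@homotopic_reparam _ _ _ _ (concat f (concat g h)) id
  (fun r => Num.min (2 * r + 0) (Num.min (1 * r + 4^-1) (2^-1 * r + 2^-1)))).
- by move=> ?; exact: cvg_id.
- by do ?[apply: continuous_minR | exact: continuous_affineR].
- by rewrite /Num.min; case: ifP; case: ifP; lra.
- by rewrite /Num.min; case: ifP; case: ifP; lra.
- by move=> t; rewrite ivalK.
- move=> t; have := ival_ge0 t; have := ival_le1 t; move: (ival t) (ivalK t) => r tr r1 r0.
  rewrite !concatE /concat_fun !concatE /concat_fun !ival_clamp -tr !ival_clamp.
  set u := Num.min _ _.
  have uP : (r <= 4^-1 /\ u = 2 * r) \/ (4^-1 < r /\ r <= 2^-1 /\ u = r + 4^-1)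
    \/ (2^-1 < r /\ u = 2^-1 * r + 2^-1).
    by rewrite /u /Num.min; case: ifP; case: ifP; lra.
  have cr : clip r = r by rewrite clip_id.
  have cu : clip u = u by rewrite clip_id //; lra.
  rewrite cr cu.
  case: uP => [[h1 ->]|[[h1 [h2 ->]]|[h1 ->]]].
  + rewrite clip_id; [|lra|lra].
    by rewrite !ifT; [|lra|lra|lra].
  + rewrite ifT; last by lra.
    rewrite ifF; last by apply/negbTE; rewrite -ltNge clip_id; lra.
    rewrite ifF; last by apply/negbTE; rewrite -ltNge; lra.
    rewrite ifT; last by rewrite clip_id; lra.
    by congr (g (clamp _)); rewrite !clip_id; lra.
  + rewrite ifF; last by apply/negbTE; rewrite -ltNge; lra.
    rewrite ifF; last by apply/negbTE; rewrite -ltNge; lra.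
    rewrite ifF; last by apply/negbTE; rewrite -ltNge clip_id; lra.
    by congr (h (clamp _)); rewrite !clip_id; lra.
Qed.

Lemma homotopic_cst_concat x y (f : {path I from x to y}) :
  homotopic (concat (cst_path x) f) f.
Proof.
apply: (@homotopic_reparam _ _ _ _ f (fun r => Num.max (0 * r + 0) (2 * r + - 1)) id).
- by do ?[apply: continuous_maxR | exact: continuous_affineR].
- by move=> ?; exact: cvg_id.
- by rewrite /Num.max; case: ifP; lra.
- by rewrite /Num.max; case: ifP; lra.
- move=> t; rewrite concatE /concat_fun; case: ifP => ht.
    rewrite max_l; last by lra.
    by rewrite mul0r addr0 -ival0 ivalK path_zero.
  by rewrite max_r //; lra.
- by move=> t; rewrite ivalK.
Qed.

Lemma homotopic_concat_cst x y (f : {path I from x to y}) :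
  homotopic (concat f (cst_path y)) f.
Proof.
apply: (@homotopic_reparam _ _ _ _ f (fun r => Num.min (2 * r + 0) (0 * r + 1)) id).
- by do ?[apply: continuous_minR | exact: continuous_affineR].
- by move=> ?; exact: cvg_id.
- by rewrite /Num.min; case: ifP; lra.
- by rewrite /Num.min; case: ifP; lra.
- move=> t; rewrite concatE /concat_fun; case: ifP => ht.
    by rewrite min_l ?addr0 //; lra.
  rewrite min_r; last by lra.
  by rewrite mul0r add0r -ival1 ivalK path_one.
- by move=> t; rewrite ivalK.
Qed.

Lemma homotopic_concat_rev x y (f : {path I from x to y}) :
  homotopic (concat f (rev_path f)) (cst_path x).
Proof.
apply: (@homotopic_reparam _ _ _ _ f
  (fun r => Num.min (2 * r + 0) (- 2 * r + 2)) (cst 0)).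
- by do ?[apply: continuous_minR | exact: continuous_affineR].
- exact: cst_continuous.
- by rewrite /Num.min /cst; case: ifP; lra.
- by rewrite /Num.min /cst; case: ifP; lra.
- move=> t; have := ival_le1 t; have := ival_ge0 t; rewrite concatE /concat_fun => t0 t1.
  case: ifP => ht; first by rewrite min_l ?addr0 //; lra.
  rewrite rev_pathE /rev_fun ival_clamp; congr (f (clamp _)).
  by rewrite min_r ?clip_id; lra.
- by move=> t; rewrite /cst -ival0 ivalK path_zero.
Qed.

Lemma homotopic_rev_concat x y (f : {path I from x to y}) :
  homotopic (concat (rev_path f) f) (cst_path y).
Proof.
apply: (@homotopic_reparam _ _ _ _ f
  (fun r => Num.max (- 2 * r + 1) (2 * r + - 1)) (cst 1)).
- by do ?[apply: continuous_maxR | exact: continuous_affineR].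
- exact: cst_continuous.
- by rewrite /Num.max /cst; case: ifP; lra.
- by rewrite /Num.max /cst; case: ifP; lra.
- move=> t; have := ival_le1 t; have := ival_ge0 t; rewrite concatE /concat_fun => t0 t1.
  case: ifP => ht.
    rewrite rev_pathE /rev_fun ival_clamp; congr (f (clamp _)).
    by rewrite max_l ?clip_id; lra.
  by rewrite max_r //; lra.
- by move=> t; rewrite /cst -ival1 ivalK path_one.
Qed.

Definition homotopicb x y (f g : {path I from x to y}) := `[< homotopic f g >].

Lemma homotopicb_refl x y : reflexive (@homotopicb x y).
Proof. by move=> f; apply/asboolP; exact: homotopic_refl. Qed.

Lemma homotopicb_sym x y : symmetric (@homotopicb x y).
Proof. by move=> f g; apply: asbool_equiv_eq; split; exact: homotopic_sym. Qed.

Lemma homotopicb_trans x y : transitive (@homotopicb x y).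
Proof.
by move=> g f h /asboolP fg /asboolP gh; apply/asboolP; exact: homotopic_trans gh.
Qed.

Definition homotopy_rel x y : equiv_rel {path I from x to y} :=
  EquivRel (@homotopicb x y) (@homotopicb_refl x y) (@homotopicb_sym x y)
    (@homotopicb_trans x y).

End homotopy.

(* The library puts the compact-open topology on the space of loops
   [{path unitI R from x to x}]; hence this is pi_1^qtop(X, x). *)
Definition pi1 (R : realType) (X : topologicalType) (x : X) : Type :=
  quotient_topology {eq_quot (@homotopy_rel R X x x)}.

HB.instance Definition _ (R : realType) (X : topologicalType) (x : X) :=
  Topological.on (pi1 R x).
HB.instance Definition _ (R : realType) (X : topologicalType) (x : X) :=
  Quotient.on (pi1 R x).

Section fundamental_group.
Context {R : realType} {X : topologicalType} {x : X}.
Local Notation I := (unitI R).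
Implicit Types f g : {path I from x to x}.

Definition loop_class f : pi1 R x := \pi_(pi1 R x) f.

Lemma loop_classP f g : loop_class f = loop_class g <-> homotopic f g.
Proof. by split=> [/eqmodP/asboolP//|fg]; apply/eqmodP/asboolP. Qed.

Lemma pi1_openP (U : set (pi1 R x)) : open U <-> open (loop_class @^-1` U).
Proof. by []. Qed.

Lemma loop_class_repr (a : pi1 R x) : loop_class (repr a) = a.
Proof. exact: reprK. Qed.

(* Independence of the representatives: [pi1_mulE] and [pi1_invE]. *)
Definition pi1_mul (a b : pi1 R x) := loop_class (concat (repr a) (repr b)).
Definition pi1_inv (a : pi1 R x) := loop_class (rev_path (repr a)).
Definition pi1_one := loop_class (cst_path x).

Lemma pi1_mulE f g : pi1_mul (loop_class f) (loop_class g) = loop_class (concat f g).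
Proof. by apply/loop_classP/homotopic_concat; apply/loop_classP/loop_class_repr. Qed.

Lemma pi1_invE f : pi1_inv (loop_class f) = loop_class (rev_path f).
Proof. by apply/loop_classP/homotopic_rev/loop_classP/loop_class_repr. Qed.

Lemma pi1_mulA : associative pi1_mul.
Proof.
move=> a b c; rewrite -[a]loop_class_repr -[b]loop_class_repr -[c]loop_class_repr.
by rewrite !pi1_mulE; apply/loop_classP/homotopic_concatA.
Qed.

Lemma pi1_mul1 : left_id pi1_one pi1_mul.
Proof.
move=> a; rewrite -[a]loop_class_repr pi1_mulE.
exact/loop_classP/homotopic_cst_concat.
Qed.

Lemma pi1_mul1r : right_id pi1_one pi1_mul.
Proof.
move=> a; rewrite -[a]loop_class_repr pi1_mulE.
exact/loop_classP/homotopic_concat_cst.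
Qed.

Lemma pi1_mulV : left_inverse pi1_one pi1_inv pi1_mul.
Proof.
move=> a; rewrite -[a]loop_class_repr pi1_invE pi1_mulE.
exact/loop_classP/homotopic_rev_concat.
Qed.

Lemma pi1_mulVr : right_inverse pi1_one pi1_inv pi1_mul.
Proof.
move=> a; rewrite -[a]loop_class_repr pi1_invE pi1_mulE.
exact/loop_classP/homotopic_concat_rev.
Qed.

HB.instance Definition _ := isGroup.Build (pi1 R x)
  pi1_mulA pi1_mul1 pi1_mul1r pi1_mulV pi1_mulVr.

End fundamental_group.

Definition generated_subgroup (G : groupType) (A : set G) : set G :=
  smallest (fun H : set G => group_closed [in H]) A.

Section small_generated.
Context (R : realType) (X : topologicalType).
Local Notation I := (unitI R).

Definition small_loop_group (y : X) : set (pi1 R y) :=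
  [set b | exists2 beta : {path I from y to y}, b = loop_class beta &
    forall V : set X, open V -> V y ->
      exists2 gamma : {path I from y to y},
        homotopic beta gamma & range gamma `<=` V].

Definition sg_generators (x : X) : set (pi1 R x) :=
  [set a | exists (y : X) (alpha : {path I from x to y})
             (beta : {path I from y to y}),
      small_loop_group (loop_class beta) /\
      a = loop_class (concat (concat alpha beta) (rev_path alpha))].

Definition sg_subgroup (x : X) : set (pi1 R x) :=
  generated_subgroup (@sg_generators x).

Definition small_generated : Prop := forall x : X, @sg_subgroup x = setT.

Lemma small_loop_group_closed (y : X) : group_closed [in @small_loop_group y].
Proof.
split.
  apply/mem_set; exists (cst_path y) => // V oV Vy.
  by exists (cst_path y); [exact: homotopic_refl|move=> _ [t _ <-]].
move=> _ _ /set_mem [f -> fS] /set_mem [g -> gS]; apply/mem_set.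
exists (concat f (rev_path g)).
  by rewrite -pi1_mulE -pi1_invE.
move=> V oV Vy.
have [f' ff' f'V] := fS V oV Vy; have [g' gg' g'V] := gS V oV Vy.
exists (concat f' (rev_path g')).
  by apply: homotopic_concat => //; exact: homotopic_rev.
move=> _ [t _ <-]; rewrite concatE /concat_fun; case: ifP => _.
  by apply: f'V; exists (clamp (2 * ival t)).
by rewrite rev_pathE /rev_fun; apply: g'V; eexists.
Qed.

End small_generated.

#[short(type="groupTopologicalType")]
HB.structure Definition GroupTopological := {G of Group G & Topological G}.

HB.instance Definition _ (R : realType) (X : topologicalType) (x : X) :=
  Group.on (pi1 R x).

Definition is_topological_group (G : groupTopologicalType) : Prop :=
  continuous (fun p : G * G => (p.1 * p.2)%g) /\ continuous (fun a : G => a^-1%g).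

Definition indiscrete (T : topologicalType) : Prop :=
  forall U : set T, open U -> U = set0 \/ U = setT.

(* Main.v *)
Require Import Defs.
From mathcomp Require Import all_boot all_order all_algebra.
From mathcomp Require Import all_classical all_reals all_analysis.
From mathcomp Require Import homotopy.

(* Suppose the class of p * q, with p ending and q starting at y, lies in an
   open set U of pi_1^qtop.  Then so does the class of (p * cst_y) * q, hence
   the preimage of U contains (p * gamma) * q for every loop gamma at y lying in
   a sufficiently small neighbourhood of y, and therefore U contains the class
   of (p * beta) * q for every small loop beta.  Consequently right
   multiplication by a generator of the SG subgroup preserves membership in
   every open set, and so does multiplication by any element of the subgroup
   they generate, here the whole group.  An indiscrete group is trivially a
   topological group. *)

Set Implicit Arguments.
Unset Strict Implicit.
Unset Printing Implicit Defensive.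

Local Open Scope classical_set_scope.

(* MathComp's [path.rev_path] would otherwise hide path reversal. *)
Local Notation rev_path := Defs.rev_path.

(** The sets [near_f V], for [V] an open neighbourhood of [y], generate a filter converging to [f],
    so one of them lies in [W]. *)
Lemma compact_open_perturb_at {S T : topologicalType} (y : T)
    (W : set {compact-open, S -> T}) (f : {compact-open, S -> T}) :
  open W -> W f ->
  exists V : set T, [/\ open V, V y &
    forall g : S -> T,
      (forall t, g t = f t \/ (f t = y /\ V (g t))) -> W g].
Proof.
move=> oW Wf.
pose near_f (V : set T) : set {compact-open, S -> T} :=
  [set g | forall t, g t = f t \/ (f t = y /\ V (g t))].
pose F := filter_from [set V | open V /\ V y] near_f.
have FF : Filter F.
  apply: filter_from_filter; first by exists setT; split => //; exact: openT.
  move=> A B [oA Ay] [oB By]; exists (A `&` B).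
    by split; [exact: openI|split].
  by move=> g gP; split=> t; case: (gP t) => [|[? []]]; auto.
have [V [oV Vy] VW] : F W.
  suff : F --> f by apply; exact: open_nbhs_nbhs.
  apply/compact_open_cvgP => K O _ oO fKO.
  (* If [y] is in [O], take [V := O]. Otherwise [f] avoids [y] on [K], so [g] agrees with [f] there
     and any [V] works. *)
  have [Oy|nOy] := pselect (O y).
    exists O => // g gP _ [t Kt <-].
    by case: (gP t) => [->|[]//]; apply: fKO; exists t.
  exists setT; first by split => //; exact: openT.
  move=> g gP _ [t Kt <-]; have Oft : O (f t) by apply: fKO; exists t.
  by case: (gP t) => [->//|[fty _]]; case: nOy; rewrite -fty.
by exists V; split => // g gP; exact: VW.
Qed.

Lemma homotopic_concatK {R : realType} {X : topologicalType} (x y z : X)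
    (f : {path unitI R from x to y}) (g : {path unitI R from y to z}) :
  homotopic (concat (concat f g) (rev_path g)) f.
Proof.
apply: homotopic_trans (homotopic_sym (homotopic_concatA _ _ _)) _.
apply: homotopic_trans (homotopic_concat_cst _).
apply: homotopic_concat; first exact: homotopic_refl.
exact: homotopic_concat_rev.
Qed.

Section open_sets_of_pi1.
Context {R : realType} {X : topologicalType} {x : X}.
Local Notation I := (unitI R).
Implicit Types (U : set (pi1 R x)) (a g : pi1 R x).

Lemma open_pi1_insert_small_loop U y (p : {path I from x to y})
    (q : {path I from y to x}) (beta : {path I from y to y}) :
  open U -> small_loop_group (loop_class beta) ->
  U (loop_class (concat p q)) ->
  U (loop_class (concat (concat p beta) q)).
Proof.
(* The preimage of [U] among loops is the trace of an open set [W] of the compact-open space of all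
   functions. *)
move=> /pi1_openP [W oW WE] [beta' /loop_classP bb' small] Upq.
have WP (f : {path I from x to x}) : W f <-> U (loop_class f).
  by rewrite -[U (loop_class f)]/((loop_class @^-1` U) f) -WE.
pose f0 := concat (concat p (cst_path y)) q.
have Wf0 : W f0.
  apply/WP; rewrite (_ : loop_class f0 = loop_class (concat p q)) //.
  apply/loop_classP/homotopic_concat; last exact: homotopic_refl.
  exact: homotopic_concat_cst.
have [V [oV Vy VW]] := compact_open_perturb_at y oW Wf0.
have [gamma b'g gV] := small V oV Vy.
suff : W (concat (concat p gamma) q).
  move/WP; rewrite (_ : loop_class _ = loop_class (concat (concat p beta) q)) //.
  apply/loop_classP/homotopic_concat; last exact: homotopic_refl.
  apply: homotopic_concat; first exact: homotopic_refl.
  by apply: homotopic_sym; exact: homotopic_trans b'g.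
(* The two loops differ only on the middle segment, where [f0] stays at [y] and [gamma] stays in
   [V]. *)
apply: VW => t; rewrite /f0 !concatE /concat_fun.
case: ifP => _; last by left.
rewrite !concatE /concat_fun; case: ifP => _; first by left.
by right; split => //; apply: gV; eexists.
Qed.

Lemma small_loop_group_rev (y : X) (beta : {path I from y to y}) :
  small_loop_group (loop_class beta) ->
  small_loop_group (loop_class (rev_path beta)).
Proof.
move=> /mem_set bS; rewrite -pi1_invE; apply/set_mem.
exact (group_closedV (@small_loop_group_closed R X y) bS).
Qed.

Lemma open_pi1_mul_sg_generator U a g :
  open U -> sg_generators g -> U a <-> U (pi1_mul a g).
Proof.
move=> oU [y [alpha [beta [bS ->]]]].
rewrite -[a]loop_class_repr; move: (repr a) => f; rewrite pi1_mulE.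
have -> : loop_class (concat f (concat (concat alpha beta) (rev_path alpha)))
        = loop_class (concat (concat (concat f alpha) beta) (rev_path alpha)).
  apply/loop_classP; apply: homotopic_trans (homotopic_concatA _ _ _) _.
  apply: homotopic_concat; last exact: homotopic_refl.
  exact: homotopic_concatA.
(* With [f] replaced by [(f * alpha) * alpha^-1], multiplying by the generator means inserting
   [beta] at [y]. Conversely, inserting the reverse of [beta] after [(f * alpha) * beta] cancels
   it. *)
rewrite -(iffRL (loop_classP _ _) (homotopic_concatK f alpha)).
split; first exact: open_pi1_insert_small_loop.
move/(open_pi1_insert_small_loop oU (small_loop_group_rev bS)).
rewrite (_ : loop_class _ = loop_class (concat (concat f alpha) (rev_path alpha))) //.
apply/loop_classP/homotopic_concat; last exact: homotopic_refl.
exact: homotopic_concatK.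
Qed.

(** The elements whose right multiplication preserves and reflects membership in [U] form a subgroup
    containing the generators; having both directions gives closure under inverses. *)
Lemma open_pi1_mul_sg_subgroup U a g :
  open U -> sg_subgroup g -> U a <-> U (pi1_mul a g).
Proof.
move=> oU gS.
pose H : set (pi1 R x) := [set h | forall b, U b <-> U (pi1_mul b h)].
apply: (gS H); split; last first.
  by move=> h hS b; exact: open_pi1_mul_sg_generator.
split; first by apply/mem_set => b; rewrite -[(1)%g]/pi1_one pi1_mul1r.
move=> h k /set_mem hH /set_mem kH; apply/mem_set => b.
rewrite -[(h / k)%g]/(pi1_mul h (pi1_inv k)) (hH b).
(* The property of [k] is used at [b * (h * k^-1)], whose product with [k] is [b * h]. *)
by rewrite (kH (pi1_mul b (pi1_mul _ _))) -!pi1_mulA pi1_mulV pi1_mul1r.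
Qed.

End open_sets_of_pi1.

Lemma indiscrete_continuous (S T : topologicalType) (f : S -> T) :
  indiscrete T -> continuous f.
Proof.
move=> indT; apply/continuousP => U /indT [->|->].
  by rewrite preimage_set0; exact: open0.
by rewrite preimage_setT; exact: openT.
Qed.

Lemma indiscrete_topological_group (G : groupTopologicalType) :
  indiscrete G -> is_topological_group G.
Proof. by move=> indG; split; exact: indiscrete_continuous. Qed.

Theorem mainTheorem3 (R : realType) (X : topologicalType)
    (hX : small_generated R X) (x : X) :
  is_topological_group (pi1 R x) /\ indiscrete (pi1 R x).
Proof.
suff ind : indiscrete (pi1 R x).
  by split=> //; exact: indiscrete_topological_group.
move=> U oU; have [->|/set0P[a Ua]] := eqVneq U set0; first by left.
right; apply/seteqP; split => // b _.
(* Right multiplication by [a^-1 * b] carries [a] to the arbitrary element [b]. *)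
have gS : sg_subgroup (pi1_mul (pi1_inv a) b) by rewrite hX.
move/(open_pi1_mul_sg_subgroup a oU gS): Ua.
by rewrite pi1_mulA pi1_mulVr pi1_mul1.
Qed.
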